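(* Let $r\ge 3$ be an integer and let $G$ be a connected $r$-regular graph of order $n$. (i) If $G$ is not (isomorphic to) the incidence graph of a projective plane of order $r-1$, then $$\gamma_{\times (r-1),t}(G)\le \frac{r(r-1)-1}{r(r-1)}\,n .$$ (ii) If $G$ is the incidence graph of a projective plane of order $r-1$ (so $n=2(r(r-1)+1)$), then $$\gamma_{\times (r-1),t}(G)=\frac{r(r-1)}{r(r-1)+1}\,n=2r(r-1).$$
   Context: All graphs are finite and simple. For a vertex $v$ of $G$, $N(v)=\{u\in V(G): uv\in E(G)\}$ is its open neighborhood. For a positive integer $k$, a $k$-tuple total dominating set of $G$ is a set $S\subseteq V(G)$ with $|N(v)\cap S|\ge k$ for every $v\in V(G)$; $\gamma_{\times k,t}(G)$ denotes the minimum cardinality of such a set. A projective plane of order $q$ consists of $q^2+q+1$ points and $q^2+q+1$ lines with an incidence relation such that every line is incident with exactly $q+1$ points, every point with exactly $q+1$ lines, any two distinct points lie on exactly one common line, and any two distinct lines share exactly one common point. Its incidence graph is the bipartite graph whose vertices are the points and the lines, a point being adjacent to a line iff they are incident. *)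

(* Defs.v *)
From HB Require Import structures.
From mathcomp Require Import all_boot all_order all_algebra.
Set Implicit Arguments. Unset Strict Implicit. Unset Printing Implicit Defensive.

Definition simple_graph (T : finType) (e : rel T) : Prop :=
  symmetric e /\ irreflexive e.

Definition nbhd (T : finType) (e : rel T) (v : T) : {set T} := [set u | e v u].

Definition regular (T : finType) (e : rel T) (r : nat) : Prop :=
  forall v : T, #|nbhd e v| = r.

Definition connected (T : finType) (e : rel T) : Prop :=
  forall x y : T, connect e x y.

Definition ktuple_tds (T : finType) (e : rel T) (k : nat) (S : {set T}) : bool :=
  [forall v, k <= #|nbhd e v :&: S|].

(* minimum cardinality of a k-tuple total dominating set
   (convention: #|T|+1 if none exists; irrelevant in the theorem) *)
Definition gamma_ktot (T : finType) (e : rel T) (k : nat) : nat :=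
  \big[minn/#|T|.+1]_(S : {set T} | ktuple_tds e k S) #|S|.

Definition projective_plane (P L : finType) (inc : P -> L -> bool) (q : nat) : Prop :=
  [/\ #|P| = q ^ 2 + q + 1 /\ #|L| = q ^ 2 + q + 1,
      (forall l : L, #|[set p | inc p l]| = q.+1),
      (forall p : P, #|[set l | inc p l]| = q.+1),
      (forall p1 p2 : P, p1 != p2 -> #|[set l | inc p1 l && inc p2 l]| = 1)
    & (forall l1 l2 : L, l1 != l2 -> #|[set p | inc p l1 && inc p l2]| = 1)].

Definition incidence_rel (P L : finType) (inc : P -> L -> bool) : rel (P + L)%type :=
  fun x y => match x, y with
             | inl p, inr l => inc p l
             | inr l, inl p => inc p l
             | _, _ => false
             end.

Definition is_pp_incidence_graph (T : finType) (e : rel T) (q : nat) : Prop :=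
  exists (P L : finType) (inc : P -> L -> bool) (f : T -> (P + L)%type),
    [/\ projective_plane inc q, bijective f &
        forall x y : T, e x y = incidence_rel inc (f x) (f y)].

(* Main.v *)
Require Import Defs.
From HB Require Import structures.
From mathcomp Require Import all_boot all_order all_algebra zify.
Import Order.TTheory GRing.Theory Num.Theory.
Set Implicit Arguments. Unset Strict Implicit. Unset Printing Implicit Defensive.

(* The complement of an (r-1)-tuple total dominating set is a set of vertices no
   two of which share a neighbour, that is, a stable set of the graph H joining
   distinct vertices with a common neighbour; H has maximum degree at most
   D = r(r-1).  By Brooks' theorem in its independence-ratio form, H has a stable
   set of size at least n/D unless it contains a clique C of size D + 1.  In that
   case every two vertices of C have exactly one common neighbour, and either G
   is bipartite with C as one side, hence the incidence graph of a projective
   plane, or C is all of G, a regular friendship graph, which is impossible. *)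

(** A strict inequality at one index would make the totals strict as well. This turns one-sided
    bounds on codegrees into exact values. *)
Lemma eq_sum_leq (I : finType) (P : pred I) (f g : I -> nat) :
    (forall i, P i -> f i <= g i) -> \sum_(i | P i) g i <= \sum_(i | P i) f i ->
  forall i, P i -> f i = g i.
Proof.
move=> le_fg le_sum i Pi; apply/eqP; rewrite eqn_leq le_fg //=.
rewrite (bigD1 i) //= [X in _ <= X](bigD1 i) //= in le_sum.
have : \sum_(j | P j && (j != i)) f j <= \sum_(j | P j && (j != i)) g j.
  by apply: leq_sum => j /andP[/le_fg].
lia.
Qed.

Lemma sum_mem_card (T : finType) (P : pred T) (A : {set T}) :
  \sum_(x | P x) (x \in A : nat) = #|[set x in A | P x]|.
Proof.
rewrite -sum1dep_card big_mkcond [RHS]big_mkcond; apply: eq_bigr => x _ /=.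
by case: (P x); case: (x \in A).
Qed.

(** * Independence ratio when all cliques have fewer than D vertices *)

Section IndependenceRatio.
Variable T : finType.
Implicit Types (h : rel T) (A I K : {set T}).

Definition stable h I := [forall x in I, forall y in I, ~~ h x y].
Definition clique h K := [forall x in K, forall y in K, (x != y) ==> h x y].

Lemma stableP h I : reflect {in I &, forall x y, ~~ h x y} (stable h I).
Proof.
apply: (iffP forall_inP) => [st x y xI yI | st x xI].
  exact: (forall_inP (st x xI)).
by apply/forall_inP => y yI; apply: st.
Qed.

Lemma cliqueP h K :
  reflect {in K &, forall x y, x != y -> h x y} (clique h K).
Proof.
apply: (iffP forall_inP) => [cl x y xK yK | cl x xK].
  by apply/implyP; apply: (forall_inP (cl x xK)).
by apply/forall_inP => y yK; apply/implyP; apply: cl.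
Qed.

Lemma stableU1 h I y : symmetric h -> irreflexive h -> stable h I ->
  {in I, forall x, ~~ h y x} -> stable h (y |: I).
Proof.
move=> sym irr /stableP st yI; apply/stableP => a b.
rewrite !in_setU1 => /predU1P[->|aI] /predU1P[->|bI].
- by rewrite irr.
- exact: yI.
- by rewrite sym yI.
- exact: st.
Qed.

(* For a maximum stable set I, the vertices whose only neighbour in I is x form
   a clique together with x; the bound follows by counting the edges leaving I. *)
Lemma stable_ratio_small_clique h A D :
    symmetric h -> irreflexive h ->
    {in A, forall x, #|[set y in A | h x y]| <= D} ->
    (forall K, K \subset A -> clique h K -> #|K| < D) ->
  exists I, [/\ I \subset A, stable h I & #|A| <= D * #|I|].
Proof.
move=> sym irr degA clA.
pose ok := [pred I : {set T} | (I \subset A) && stable h I].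
have ok0 : ok set0.
  by rewrite /= sub0set; apply/stableP => x y; rewrite inE.
case: (@arg_maxnP _ set0 ok (fun I : {set T} => #|I|) ok0) => I /andP[IA stI] maxI.
exists I; split=> //.
pose dI y := #|[set x in I | h y x]|.
pose P x := [set y in A :\: I | [set z in I | h y z] == [set x]].
have dI_gt0 y : y \in A :\: I -> 0 < dI y.
  rewrite inE => /andP[yI yA]; rewrite lt0n cards_eq0; apply/eqP => d0.
  have := maxI (y |: I); rewrite /= subUset sub1set yA IA /= cardsU1 yI.
  rewrite stableU1 // => [/(_ isT)|x xI]; first by rewrite /=; lia.
  by apply/negP => hyx; have := in_set0 x; rewrite -d0 inE xI hyx.
have P_clique x : x \in I -> clique h (x |: P x).
  move=> xI; apply/cliqueP.
  have Px y : y \in P x -> h x y.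
    rewrite inE => /andP[_ /eqP E]; have := set11 x.
    by rewrite -E inE sym => /andP[].
  move=> y z; rewrite !in_setU1 => /predU1P[->|yP] /predU1P[->|zP] neq.
  - by rewrite eqxx in neq.
  - exact: Px.
  - by rewrite sym Px.
  apply/negPn/negP => nyz.
  move: yP zP; rewrite !inE.
  case/andP=> [/andP[yI yA] /eqP Ey] /andP[/andP[zI zA] /eqP Ez].
  have priv w t : [set z0 in I | h w z0] = [set x] -> t \in I :\ x -> ~~ h w t.
    move=> E; rewrite !inE => /andP[tx tI]; apply/negP => hwt.
    by have := in_set1 t x; rewrite -E inE tI hwt (negPf tx).
  have IxA : I :\ x \subset A by apply: subset_trans IA; apply: subD1set.
  have stIx : stable h (I :\ x).
    by apply/stableP => a b /setD1P[_ aI] /setD1P[_ bI]; apply: (stableP _ _ stI).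
  (* Exchange: with [y] and [z] not adjacent, replacing [x] by both of them would give a larger
     stable set. *)
  have /= := maxI (y |: (z |: I :\ x)).
  rewrite !subUset !sub1set yA zA IxA !cardsU1 !inE (negPf yI) (negPf zI).
  rewrite (negPf neq) !andbF /= (cardsD1 x I) xI.
  suff -> : stable h (y |: (z |: I :\ x)) by move=> /(_ isT); rewrite !add1n ltnn.
  apply: stableU1 => // [|t]; first by apply: stableU1 => // t; apply: priv.
  by rewrite in_setU1 => /predU1P[->|]; last exact: priv.
have P_card x : x \in I -> #|P x|.+2 <= D.
  move=> xI; have := clA (x |: P x); rewrite subUset sub1set (subsetP IA) //=.
  rewrite cardsU1 !inE xI /= add1n P_clique //; apply=> //.
  by apply/subsetP => y; rewrite !inE => /andP[/andP[]].
have edges : \sum_(y in A :\: I) dI y <= D * #|I|.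
  have -> : \sum_(y in A :\: I) dI y
            = \sum_(x in I) #|[set y in A :\: I | h x y]|.
    transitivity (\sum_(y in A :\: I) \sum_(x in I) (h x y : nat)).
      apply: eq_bigr => y _; rewrite /dI -sum1dep_card big_mkcondr /=.
      by apply: eq_bigr => x _; rewrite sym; case: (h x y).
    rewrite exchange_big; apply: eq_bigr => x _ /=.
    rewrite -sum1dep_card [RHS]big_mkcondr /=.
    by apply: eq_bigr => y _; case: (h x y).
  rewrite mulnC -sum_nat_const; apply: leq_sum => x xI.
  apply: leq_trans (degA x (subsetP IA x xI)).
  by apply/subset_leq_card/subsetP => y; rewrite !inE => /andP[/andP[_ ->]].
have singles : \sum_(y in A :\: I) (dI y == 1 : nat) <= \sum_(x in I) #|P x|.
  have -> : \sum_(x in I) #|P x| = \sum_(y in A :\: I) \sum_(x in I) (y \in P x : nat).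
    rewrite exchange_big; apply: eq_bigr => x _ /=.
    rewrite sum_mem_card; apply: eq_card => y; rewrite !inE.
    by case: (y \in I); case: (y \in A); rewrite ?andbT ?andbF.
  apply: leq_sum => y yAI; case: eqP => //= /eqP/cards1P[x Ex].
  have xI : x \in I by have := set11 x; rewrite -Ex inE => /andP[].
  rewrite (bigD1 x) //=; suff -> : y \in P x by [].
  by rewrite inE yAI Ex eqxx.
have priv_bound : \sum_(x in I) #|P x| + 2 * #|I| <= D * #|I|.
  rewrite mulnC [D * _]mulnC -!sum_nat_const -big_split /=; apply: leq_sum => x /P_card.
  by lia.
(* A vertex outside [I] sends one edge into [I] if it is private and at least two otherwise. Hence
   2|A - I| is at most D|I| ([edges]) plus (D - 2)|I| ([priv_bound]), and so |A - I| is at most (D -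
   1)|I|. *)
have outside : 2 * #|A :\: I| <= \sum_(y in A :\: I) (dI y + (dI y == 1 : nat)).
  rewrite mulnC -sum_nat_const; apply: leq_sum => y /dI_gt0.
  by case: (dI y) => [|[|]].
rewrite big_split /= in outside.
have := cardsID I A; rewrite (setIidPr IA); lia.
Qed.

End IndependenceRatio.

(** * Regular friendship graphs: a trace argument modulo a prime *)

Section Friendship.
Local Open Scope ring_scope.

(** Write B = CR with C of full column rank and R of full row rank. Cancelling C and R in CRCR = 0
    gives RC = 0, and CR and RC have the same trace. *)
Lemma mxtrace_square_zero (F : fieldType) n (B : 'M[F]_n) :
  B *m B = 0 -> \tr B = 0.
Proof.
move=> BB; rewrite -(mulmx_base B) mxtrace_mulC.
suff -> : row_base B *m col_base B = 0 by rewrite mxtrace0.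
apply: (row_free_inj (row_base_free B)); rewrite mul0mx.
apply: (row_full_inj (col_base_full B)).
rewrite mulmx0 -(mulmxA (row_base B)) (mulmxA (col_base B)) mulmx_base.
exact: BB.
Qed.

(* Modulo a prime p dividing r - 1 the adjacency matrix A satisfies A^2 = AJ = J,
   and J^2 = J, so that A - J squares to 0, whereas its trace is -1. *)
Lemma no_regular_friendship (T : finType) (e : rel T) r :
    (3 <= r)%N -> symmetric e -> irreflexive e -> regular e r ->
    #|T| = (r * (r - 1)).+1 ->
  ~ (forall x y, x != y -> #|nbhd e x :&: nbhd e y| = 1%N).
Proof.
move=> r3 sym irr reg cardT fr.
pose p := pdiv (r - 1).
have pp : prime p by apply: pdiv_prime; lia.
have r0 : (r - 1)%:R = 0 :> 'F_p.
  by apply/eqP; rewrite -(dvdn_pcharf (pchar_Fp pp)) pdiv_dvd.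
have r1 : r%:R = 1 :> 'F_p.
  have E : r = (r - 1).+1 by lia.
  by rewrite [in LHS]E -natr1 r0 add0r.
have n1 : #|T|%:R = 1 :> 'F_p.
  by rewrite cardT -natr1 natrM r0 mulr0 add0r.
pose J : 'M['F_p]_#|T| := const_mx 1.
pose A : 'M['F_p]_#|T| := \matrix_(i, j) (e (enum_val i) (enum_val j))%:R.
have sumE (F : T -> 'F_p) : \sum_(i < #|T|) F (enum_val i) = \sum_x F x.
  rewrite [RHS](reindex (@enum_val T predT)) //=.
  by apply: onW_bij; apply: enum_val_bij.
have sum_card (P : pred T) : \sum_x (P x)%:R = #|[set x | P x]|%:R :> 'F_p.
  by rewrite -natr_sum -sum1dep_card [in RHS]big_mkcond.
have AJ : A *m J = J.
  apply/matrixP => i j; rewrite !mxE.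
  under eq_bigr do rewrite !mxE mulr1.
  by rewrite (sumE (fun x => (e _ x)%:R)) sum_card reg r1.
have JA : J *m A = J.
  have At : A^T = A by apply/matrixP => i j; rewrite !mxE sym.
  have Jt : J^T = J by apply/matrixP => i j; rewrite !mxE.
  by apply: trmx_inj; rewrite trmx_mul At Jt.
have JJ : J *m J = J.
  apply/matrixP => i j; rewrite !mxE.
  under eq_bigr do rewrite !mxE mulr1.
  by rewrite sumr_const card_ord n1.
(* The entries of the square are r on the diagonal, which is 1 modulo p, and the numbers of common
   neighbours elsewhere, which are 1. *)
have AA : A *m A = J.
  apply/matrixP => i j; rewrite !mxE.
  under eq_bigr do rewrite !mxE -natrM mulnb [X in _ && X]sym.
  rewrite (sumE (fun x => (e _ x && e _ x)%:R)) sum_card.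
  case: (eqVneq i j) => [->|ij].
    suff -> : [set x | e (enum_val j) x && e (enum_val j) x] = nbhd e (enum_val j).
      by rewrite reg r1.
    by apply/setP => x; rewrite !inE andbb.
  suff -> : [set x | e (enum_val i) x && e (enum_val j) x]
            = nbhd e (enum_val i) :&: nbhd e (enum_val j).
    by rewrite fr // (inj_eq enum_val_inj).
  by apply/setP => x; rewrite !inE.
have /mxtrace_square_zero/eqP : (A - J) *m (A - J) = 0.
  by rewrite mulmxBl !mulmxBr AA AJ JA JJ !subrr.
have trA : \tr A = 0.
  by rewrite /mxtrace big1 // => i _; rewrite mxE irr.
have trJ : \tr J = 1.
  by rewrite /mxtrace; under eq_bigr do rewrite mxE; rewrite sumr_const card_ord n1.
by rewrite raddfB /= trA trJ sub0r oppr_eq0 oner_eq0.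
Qed.
End Friendship.

Lemma exists_mem_notin (T : finType) (A : {set T}) (s : seq T) :
  size s < #|A| -> exists2 x, x \in A & x \notin s.
Proof.
move=> lt; apply/exists_inP; apply: contraTT lt => /exists_inPn sub.
rewrite -leqNgt; apply: leq_trans (card_size s).
by apply/subset_leq_card/subsetP => x /sub; rewrite negbK.
Qed.

(** * Brooks' theorem as a bound on stable sets *)

Section Brooks.
Variable T : finType.
Implicit Types (h : rel T) (A I K : {set T}).

Definition add_edge h u v : rel T :=
  fun a b => [|| h a b, (a == u) && (b == v) | (a == v) && (b == u)].

Lemma add_edgeC h u v : add_edge h u v =2 add_edge h v u.
Proof. by move=> a b; rewrite /add_edge [X in _ || X]orbC. Qed.

Lemma add_edge_sym h u v : symmetric h -> symmetric (add_edge h u v).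
Proof.
by move=> sym a b; rewrite /add_edge sym [X in _ || X]orbC ![(b == _) && _]andbC.
Qed.

Lemma add_edge_id h u v a b : a != u -> a != v -> add_edge h u v a b = h a b.
Proof. by rewrite /add_edge => /negPf-> /negPf->; rewrite orbF. Qed.

(* Brooks' theorem for the independence ratio.  If K is a clique of size D, each
   of its vertices has at most one neighbour outside K.  Delete K and join the
   outer neighbours f x <> f y of two vertices of K: a stable set of the smaller
   graph misses one of them, so it extends by x or y.  The new edge can create a
   clique of size D + 1 for at most one choice of the pair. *)
Theorem stable_ratio h A D :
    2 < D -> symmetric h -> irreflexive h ->
    {in A, forall x, #|[set y in A | h x y]| <= D} ->
    (forall K, K \subset A -> clique h K -> #|K| <= D) ->
  exists I, [/\ I \subset A, stable h I & #|A| <= D * #|I|].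
Proof.
move=> D3; have [n] := ubnP #|A|.
elim: n => // n IHn in h A * => ltAn sym irr degA clA.
have [/existsP[K /and3P[KA clK /eqP cK]]|noK] :=
  boolP [exists K : {set T}, [&& K \subset A, clique h K & #|K| == D]]; last first.
  apply: stable_ratio_small_clique => // K KA clK.
  rewrite ltn_neqAle clA // andbT; apply: contra noK => cK.
  by apply/existsP; exists K; apply/and3P.
have cA : #|A| = D + #|A :\: K| by rewrite -(cardsID K A) (setIidPr KA) cK.
have AK_A : A :\: K \subset A by apply: subsetDl.
pose outer x := [set y in A :\: K | h x y].
(* Of the at most D neighbours of [x], D - 1 already lie in the clique [K]. *)
have outer_le1 x : x \in K -> #|outer x| <= 1.
  move=> xK; have := degA x (subsetP KA x xK).
  rewrite -(cardsID K) /= -[X in _ <= X](subnKC (ltnW (ltnW D3))).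
  have := cardsD1 x K; rewrite xK cK.
  have -> : [set y in A | h x y] :&: K = K :\ x.
    apply/setP => y; rewrite !inE; case: (eqVneq y x) => [->|yx] /=.
      by rewrite irr andbF.
    have [yK|] := boolP (y \in K); last by rewrite andbF.
    by rewrite (subsetP KA) // (cliqueP _ _ clK) // eq_sym.
  have -> : [set y in A | h x y] :\: K = outer x.
    by apply/setP => y; rewrite !inE andbA.
  lia.
(* Restoring [K] adds D vertices to the graph, which the single new member [x] of the stable set
   pays for. *)
have extend x I : x \in K -> I \subset A :\: K -> stable h I ->
    {in I, forall y, ~~ h x y} -> #|A :\: K| <= D * #|I| ->
    exists I, [/\ I \subset A, stable h I & #|A| <= D * #|I|].
  move=> xK IAK stI xI le; exists (x |: I); split.
  - by rewrite subUset sub1set (subsetP KA) // (subset_trans IAK).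
  - exact: stableU1.
  rewrite cardsU1 (contraTN _ xK) => [|/(subsetP IAK)]; first by rewrite cA mulnDr muln1; lia.
  by rewrite inE => /andP[].
have ltAKn : #|A :\: K| < n by lia.
have [/exists_inP[x xK /eqP out0]|no0] := boolP [exists x in K, outer x == set0].
  have [||I [IA stI leI]] := IHn h (A :\: K) ltAKn sym irr.
  - move=> y yAK; apply: leq_trans (degA y (subsetP AK_A y yAK)).
    apply/subset_leq_card/subsetP => z; rewrite !inE.
    by case/andP => /andP[_ ->].
  - by move=> K' K'A; apply: clA; apply: subset_trans AK_A.
  apply: (extend x I) => // y yI; apply/negP => hxy.
  by have := in_set0 y; rewrite -out0 inE (subsetP IA) // hxy.
(* From here on every [outer x] with [x] in [K] is a singleton, so [f x] is its element and the
   default is never taken. *)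
pose f x := odflt x [pick y in outer x].
have outerE x : x \in K -> outer x = [set f x].
  move=> xK; have /cards1P[y Ey] : #|outer x| == 1.
    rewrite eqn_leq outer_le1 // card_gt0.
    by have /exists_inPn/(_ x xK) := no0.
  rewrite /f Ey; case: pickP => [z|/(_ y)]; rewrite inE ?eqxx //.
  by move/eqP->.
have fP x y : x \in K -> (y \in A :\: K) && h x y = (y == f x).
  by move=> xK; rewrite -(in_set1 y (f x)) -(outerE x xK) [in RHS]inE.
have fAK x : x \in K -> f x \in A :\: K.
  by move=> xK; have := fP x (f x) xK; rewrite eqxx => /andP[].
have hf x : x \in K -> h x (f x).
  by move=> xK; have := fP x (f x) xK; rewrite eqxx => /andP[].
(* A common outer neighbour of all of [K] would complete it to a clique of size D + 1. *)
have [x xK [y yK fxy]] : exists2 x, x \in K & exists2 y, y \in K & f x != f y.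
  have /card_gt0P[x xK] : 0 < #|K| by lia.
  exists x => //; have [/exists_inP//|/exists_inPn const] :=
    boolP [exists y in K, f x != f y].
  have fxK : f x \notin K by have := fAK x xK; rewrite inE => /andP[].
  have := clA (f x |: K); rewrite subUset sub1set (subsetP AK_A) ?fAK // KA.
  rewrite cardsU1 fxK cK add1n ltnn => /(_ isT) notcl.
  have hfx z : z \in K -> h z (f x).
    by move=> zK; have := const z zK; rewrite negbK => /eqP->; apply: hf.
  suff /notcl : clique h (f x |: K) by [].
  apply/cliqueP => a b.
  rewrite !in_setU1 => /predU1P[->|aK] /predU1P[->|bK] ab.
  - by rewrite eqxx in ab.
  - by rewrite sym hfx.
  - exact: hfx.
  - exact: (cliqueP _ _ clK).
(* An outer neighbour loses an edge when [K] is deleted, which leaves room for the added edge within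
   the degree bound D. *)
have deg_lt a c : a \in A :\: K -> c \in K -> h a c ->
    #|[set b in A :\: K | h a b]| < D.
  move=> aAK cKK hac; apply: leq_trans (degA a (subsetP AK_A a aAK)).
  apply/proper_card/properP; split.
    by apply/subsetP => z; rewrite !inE => /andP[/andP[_ ->]].
  by exists c; rewrite !inE ?cKK // (subsetP KA).
have deg_le a c v : a \in A :\: K -> c \in K -> h a c ->
    #|[set b in A :\: K | add_edge h a v a b]| <= D.
  move=> aAK cKK hac; apply: leq_trans (deg_lt a c aAK cKK hac).
  have : #|[set b in A :\: K | add_edge h a v a b]|
         <= #|v |: [set b in A :\: K | h a b]|.
    apply/subset_leq_card/subsetP => z; rewrite !inE /add_edge eqxx /=.
    case/andP=> -> /or3P[->|->|/andP[/eqP-> /eqP->]]; by rewrite ?orbT ?eqxx.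
  move/leq_trans; apply; rewrite cardsU1.
  by case: (_ \notin _); rewrite ?add1n ?add0n // leqW.
(* Induction on the graph with the extra edge either gives a stable set that avoids [f a] or [f b],
   hence extends, or is blocked by a clique that is too large. *)
have step a b : a \in K -> b \in K -> f a != f b ->
    (exists I, [/\ I \subset A, stable h I & #|A| <= D * #|I|]) \/
    exists K', [/\ K' \subset A :\: K, clique (add_edge h (f a) (f b)) K' & D < #|K'|].
  move=> aK bK fab; pose h' := add_edge h (f a) (f b).
  have [/existsP[K' /and3P[s1 s2 s3]]|noK'] := boolP [exists K' : {set T},
    [&& K' \subset A :\: K, clique h' K' & D < #|K'|]].
    by right; exists K'.
  left; have [||||I [IA stI leI]] := IHn h' (A :\: K) ltAKn.
  - exact: add_edge_sym.
  - move=> z; rewrite /h' /add_edge irr /=.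
    by apply/orP => -[] /andP[/eqP-> /eqP E]; move: fab; rewrite E eqxx.
  - move=> z zAK; have [->|za] := eqVneq z (f a).
      by apply: (deg_le _ a); rewrite ?fAK // sym hf.
    have [->|zb] := eqVneq z (f b).
      under eq_finset do rewrite /h' add_edgeC.
      by apply: (deg_le _ b); rewrite ?fAK // sym hf.
    apply: leq_trans (degA z (subsetP AK_A z zAK)).
    apply/subset_leq_card/subsetP => t.
    by rewrite !inE /h' add_edge_id // => /andP[/andP[_ ->]].
  - move=> K' K'A clK'; rewrite leqNgt; apply: contra noK' => lt.
    by apply/existsP; exists K'; apply/and3P.
  have stI' : stable h I.
    apply/stableP => s t sI tI; have := stableP _ _ stI s t sI tI.
    by apply: contra; rewrite /h' /add_edge => ->.
  have ext c : c \in K -> f c \notin I ->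
      exists I, [/\ I \subset A, stable h I & #|A| <= D * #|I|].
    move=> cK' fcI; apply: (extend c I) => // t tI.
    apply/negP => hct; have := fP c t cK'; rewrite (subsetP IA) // hct /=.
    by move/esym/eqP => E; rewrite -E tI in fcI.
  have [faI|] := boolP (f a \in I); last exact: ext.
  have [fbI|] := boolP (f b \in I); last exact: ext.
  by have := stableP _ _ stI _ _ faI fbI; rewrite /h' /add_edge !eqxx orbT.
have [//|[K' [K'A clK' cK']]] := step x y xK yK fxy.
have in_nbhd (S : {set T}) a c : a \in A -> S \subset [set b in A | h a b] ->
    D <= #|S| -> c \in A -> h a c -> c \in S.
  move=> aA SA leD cAA hac; have /eqP -> : S == [set b in A | h a b].
    by rewrite eqEcard SA (leq_trans (degA a aA)).
  by rewrite inE cAA.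
have K'_A b : b \in K' -> b \in A by move=> bK'; rewrite (subsetP AK_A) // (subsetP K'A).
have K'_K b : b \in K' -> b \notin K by move/(subsetP K'A); rewrite inE => /andP[].
(* Without an end of the new edge, the clique would already be one of [h], where D vertices is the
   limit. *)
have mem_new a b (S : {set T}) : S \subset A -> clique (add_edge h a b) S -> D < #|S| -> a \in S.
  move=> SA clS; apply: contraLR => aS; rewrite -leqNgt; apply: clA => //.
  apply/cliqueP => s t sS tS st; have := cliqueP _ _ clS s t sS tS st.
  case/or3P=> // /andP[/eqP E1 /eqP E2].
    by rewrite -E1 sS in aS.
  by rewrite -E2 tS in aS.
have K'A' : K' \subset A by apply: subset_trans AK_A.
have fxK' : f x \in K' by apply: mem_new clK' cK'.
have fyK' : f y \in K'.
  apply: (mem_new _ (f x) K') => //; apply/cliqueP => s t sS tS st.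
  by rewrite add_edgeC; apply: (cliqueP _ _ clK').
(* Away from the ends of the new edge, the other members of [K'] already make up the full D
   neighbours of [b]. *)
have nbhd_in b c : b \in K' -> b != f x -> b != f y -> c \in A -> h b c -> c \in K'.
  move=> bK' bx by_ cAA hbc; suff: c \in K' :\ b by rewrite inE => /andP[].
  apply: (in_nbhd _ b) => //; first exact: K'_A.
    apply/subsetP => t; rewrite !inE => /andP[tb tK']; rewrite K'_A //=.
    by rewrite -(add_edge_id h t bx by_) (cliqueP _ _ clK') // eq_sym.
  by move: cK'; rewrite (cardsD1 b K') bK' add1n ltnS.
(* At an end of the new edge, the vertex [a] and the at least D - 1 members of [K'] other than the
   two ends exhaust the neighbours of [f a]. *)
have nbhd_end a b c : a \in K -> f a \in K' -> f b \in K' -> f a != f b ->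
    clique (add_edge h (f a) (f b)) K' -> c \in A -> h (f a) c ->
    c = a \/ c \in K' :\ f a :\ f b.
  move=> aK faK' fbK' fab cl cAA hac.
  suff: c \in a |: K' :\ f a :\ f b by case/setU1P; [left|right].
  apply: (in_nbhd _ (f a)) => //; first exact: K'_A.
    apply/subsetP => t; rewrite in_setU1 => /predU1P[->|].
      by rewrite inE (subsetP KA) // sym hf.
    rewrite !inE => /and3P[tb ta tK']; rewrite K'_A //= sym.
    by rewrite -(add_edge_id h _ ta tb) (cliqueP _ _ cl).
  move: cK'; rewrite (cardsD1 (f a) K') (cardsD1 (f b) (K' :\ f a)) faK'.
  rewrite cardsU1 !in_setD1 fbK' eq_sym fab (negPf (contraTN (K'_K a) aK)) !andbF.
  by rewrite !add1n ltnS.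
(* D > 2 provides a third vertex [z] of [K]. Its outer neighbour differs from [f x] and [f y], whose
   neighbourhoods are now known, so the pair [x], [z] can be tried instead. *)
have /exists_mem_notin[z zK] : size [:: x; y] < #|K| by rewrite cK.
rewrite !inE negb_or => /andP[zx zy].
have zA : z \in A by apply: (subsetP KA).
have znK' u v : z \notin K' :\ u :\ v.
  by rewrite !inE (negPf (contraTN (K'_K z) zK)) !andbF.
have fzx : f z != f x.
  apply/eqP => E; have [|/eqP|] :=
    nbhd_end x y z xK fxK' fyK' fxy clK' zA.
  - by rewrite -E sym hf.
  - by rewrite (negPf zx).
  - exact/negP/znK'.
have fzy : f z != f y.
  apply/eqP => E; have [|||/eqP|] :=
    nbhd_end y x z yK fyK' fxK' _ _ zA.
  - by rewrite eq_sym.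
  - by apply/cliqueP => s t sS tS st; rewrite add_edgeC (cliqueP _ _ clK').
  - by rewrite -E sym hf.
  - by rewrite (negPf zy).
  - exact/negP/znK'.
rewrite eq_sym in fzx.
have [//|[K2 [K2A clK2 cK2]]] := step x z xK zK fzx.
(* If that pair is blocked by [K2] too, a third vertex [t] of [K2] is adjacent in [h] to both [f x]
   and [f z]. Then saturation drags [t], [f z] and finally [z] into [K'], which is disjoint from
   [K]. *)
have /exists_mem_notin[t tK2] : size [:: f x; f z] < #|K2|.
  exact: ltn_trans cK2.
rewrite !inE negb_or => /andP[tx tz].
have K2A' : K2 \subset A by apply: subset_trans AK_A.
have tA : t \in A by apply: (subsetP K2A').
have fxK2 : f x \in K2 by apply: mem_new clK2 cK2.
have fzK2 : f z \in K2.
  apply: (mem_new _ (f x) K2) => //; apply/cliqueP => s s' sS tS st.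
  by rewrite add_edgeC; apply: (cliqueP _ _ clK2).
have tfx : h t (f x) by rewrite -(add_edge_id h _ tx tz) (cliqueP _ _ clK2).
have tfz : h t (f z) by rewrite -(add_edge_id h _ tx tz) (cliqueP _ _ clK2).
have [|tE|] := nbhd_end x y t xK fxK' fyK' fxy clK' tA.
- by rewrite sym.
- by have := subsetP K2A t tK2; rewrite tE inE xK.
rewrite !inE => /and3P[ty _ tK'].
have fzK' : f z \in K'.
  by apply: (nbhd_in t); rewrite // (subsetP AK_A) // fAK.
have : z \in K'.
  by apply: (nbhd_in (f z) z fzK' _ fzy zA); rewrite 1?sym ?hf // eq_sym.
by move/K'_K; rewrite zK.
Qed.
End Brooks.

(** * The graph H of pairs with a common neighbour *)

Section CommonNeighbours.
Variables (T : finType) (e : rel T).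
Hypothesis (sym : symmetric e).

Definition codegree x y := #|nbhd e x :&: nbhd e y|.

Definition share_nbr : rel T := fun x y => (x != y) && (0 < codegree x y).

Lemma codegreeC x y : codegree x y = codegree y x.
Proof. by rewrite /codegree setIC. Qed.

Lemma share_nbr_sym : symmetric share_nbr.
Proof. by move=> x y; rewrite /share_nbr eq_sym codegreeC. Qed.

Lemma share_nbr_irr : irreflexive share_nbr.
Proof. by move=> x; rewrite /share_nbr eqxx. Qed.

Lemma codegree_gt0 x y z : e x z -> e y z -> 0 < codegree x y.
Proof. by move=> xz yz; apply/card_gt0P; exists z; rewrite !inE xz. Qed.

(** There are r * r walks of length two from [x], and r of them return to [x]. *)
Lemma sum_codegree r x :
  regular e r -> \sum_(y | y != x) codegree x y = r * (r - 1).
Proof.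
move=> reg; have codE y : codegree x y = \sum_(z in nbhd e x) (e z y : nat).
  rewrite /codegree -sum1_card [RHS]big_mkcond [LHS]big_mkcond.
  apply: eq_bigr => z _; rewrite !inE [e y z]sym.
  by case: (e x z); case: (e z y).
have : \sum_y codegree x y = r * r.
  under eq_bigr do rewrite codE.
  rewrite exchange_big /= -{1}(reg x) -sum_nat_const; apply: eq_bigr => z _.
  by rewrite -(reg z) -sum1dep_card [RHS]big_mkcond.
rewrite (bigD1 x) //= {1}/codegree setIid reg mulnBr muln1 => <-.
by rewrite addKn.
Qed.

Lemma degree_share_nbr r x : regular e r -> #|[set y | share_nbr x y]| <= r * (r - 1).
Proof.
move=> /sum_codegree-/(_ x) <-; rewrite -sum1dep_card [X in X <= _]big_mkcondr /=.
under eq_bigl do rewrite eq_sym.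
by apply: leq_sum => y _; case: ifP.
Qed.

End CommonNeighbours.

Lemma connected_closed (T : finType) (e : rel T) (P : {set T}) x :
  symmetric e -> connected e ->
  x \in P -> (forall y z, e y z -> y \in P -> z \in P) -> P = setT.
Proof.
move=> sym conn xP clP; apply/setP => y; rewrite inE.
have /closed_connect/(_ _ _ (conn x y)) <- // : closed e (mem P).
by apply: intro_closed => //; apply: sym_connect_sym.
Qed.

(** * A clique of size D + 1 in H forces a projective plane *)

Section LargeClique.
Variables (T : finType) (e : rel T) (r : nat) (C : {set T}).
Hypotheses (r3 : 3 <= r) (sym : symmetric e) (irr : irreflexive e).
Hypotheses (conn : connected e) (reg : regular e r).
Hypotheses (clC : clique (share_nbr e) C) (cardC_gt : r * (r - 1) < #|C|).

(** The codegrees at [x] sum to r(r - 1), and the at least r(r - 1) other members of [C] take at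
    least one each, so nothing is left over. *)
Lemma codegree_clique x y : x \in C -> y != x -> codegree e x y = (y \in C).
Proof.
move=> xC yx; apply/esym; move: y yx; apply: eq_sum_leq => [y yx|].
  have [yC|//] := boolP (y \in C).
  by have := cliqueP _ _ clC x y xC yC; rewrite eq_sym yx => /(_ isT)/andP[].
rewrite (sum_codegree sym x reg) sum_mem_card.
have -> : [set y in C | y != x] = C :\ x by apply/setP => y; rewrite !inE andbC.
by move: cardC_gt; rewrite (cardsD1 x) xC add1n ltnS.
Qed.

Lemma card_clique : #|C| = (r * (r - 1)).+1.
Proof.
have /card_gt0P[x xC] : 0 < #|C| by apply: leq_trans cardC_gt.
rewrite (cardsD1 x) xC add1n -(sum_codegree sym x reg); congr _.+1.
under eq_bigr => y yx do rewrite (codegree_clique xC yx).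
by rewrite sum_mem_card; apply: eq_card => y; rewrite !inE andbC.
Qed.

Lemma clique_step2 x y z : x \in C -> e x z -> e y z -> y \in C.
Proof.
move=> xC xz yz; have [->//|yx] := eqVneq y x.
by have := codegree_gt0 xz yz; rewrite codegree_clique //; case: (y \in C).
Qed.

(** Membership in [C] spreads along walks of length two. An edge inside [C] would therefore spread
    [C] over the whole connected graph, making it a regular friendship graph. Since [C] and its
    neighbours exhaust the graph, an edge outside [C] would continue an edge from [C] and pull its
    far end into [C]. *)
Lemma clique_bipartite x y : e x y -> (x \in C) = (y \notin C).
Proof.
have noedge a b : e a b -> a \in C -> b \notin C.
  move=> ab aC; apply/negP => bC.
  have CT : C = setT.
    suff E : C :&: [set u | [exists v in C, e u v]] = setT.
      by apply/eqP; rewrite -subTset -E subsetIl.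
    apply: (connected_closed (x := a) sym conn) => [|u v uv].
      by rewrite !inE aC; apply/exists_inP; exists b.
    rewrite !inE => /andP[uC /exists_inP[w wC uw]].
    have vC : v \in C by apply: (clique_step2 wC) (_ : e v u); rewrite sym.
    by rewrite vC; apply/exists_inP; exists u => //; rewrite sym.
  have cT : #|T| = (r * (r - 1)).+1 by rewrite -card_clique CT cardsT.
  apply: (no_regular_friendship r3 sym irr reg cT) => u v uv.
  by have := @codegree_clique u v; rewrite CT !inE eq_sym => /(_ isT uv).
move=> xy; apply/idP/idP => [|yC]; first exact: noedge.
have /card_gt0P[a aC] : 0 < #|C| by rewrite card_clique.
have : x \in C :|: [set u | [exists v in C, e u v]].
  suff -> : C :|: [set u | [exists v in C, e u v]] = setT by rewrite inE.
  apply: (connected_closed (x := a) sym conn) => [|u v uv]; rewrite !inE ?aC //.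
  case/orP => [uC|/exists_inP[w wC uw]].
    by apply/orP; right; apply/exists_inP; exists u => //; rewrite sym.
  by rewrite (clique_step2 wC (_ : e w u) (_ : e v u)) // sym.
rewrite !inE => /orP[//|/exists_inP[w wC xw]].
by rewrite (clique_step2 wC _ (_ : e y x)) ?(sym y) // sym in yC.
Qed.

(** Every edge crosses between [C] and its complement; counting the edges from each side gives r
    times either size. *)
Lemma card_clique_compl : #|~: C| = (r * (r - 1)).+1.
Proof.
rewrite -card_clique; apply/eqP; rewrite -(eqn_pmul2r (ltnW (ltnW r3))).
rewrite -!sum_nat_const; apply/eqP.
transitivity (\sum_(x in ~: C) \sum_(y in C) (e x y : nat)).
  apply: eq_bigr => x xC; rewrite -(reg x) -sum1_card big_mkcond [RHS]big_mkcond.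
  apply: eq_bigr => y _; rewrite inE; have [xy|] := boolP (e x y); last by case: ifP.
  by move: xC; rewrite inE (clique_bipartite xy) negbK => ->.
rewrite exchange_big; apply: eq_bigr => y yC /=.
rewrite -(reg y) -sum1_card big_mkcond [RHS]big_mkcond.
apply: eq_bigr => x _; rewrite !inE sym; have [xy|] := boolP (e y x); last by case: ifP.
by rewrite -(clique_bipartite xy) yC.
Qed.

(** Two common neighbours of [x] and [y] would be members of [C] with codegree at least 2. So
    codegrees in the complement are at most 1, and their total r(r - 1) forces equality. *)
Lemma codegree_clique_compl x y :
  x \notin C -> y != x -> codegree e x y = (y \notin C).
Proof.
move=> xC yx; move: y yx; apply: eq_sum_leq => [y yx|].
  have [yC|yC] := boolP (y \in C).
    rewrite leqn0 cards_eq0; apply/eqP/setP => z; rewrite !inE.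
    apply/negP => /andP[/clique_bipartite xz /clique_bipartite yz].
    by rewrite -yz yC in xz; rewrite xz in xC.
  rewrite leqNgt; apply/card_gt1P => -[z [t [zI tI zt]]].
  move: zI tI; rewrite !inE => /andP[xz yz] /andP[xt yt].
  have zC : z \in C by have := clique_bipartite xz; rewrite (negPf xC); case: (z \in C).
  have tz : t != z by rewrite eq_sym.
  have : 1 < codegree e z t.
    by apply/card_gt1P; exists x, y; rewrite !inE ![e z _]sym ![e t _]sym xz yz xt yt eq_sym.
  by rewrite codegree_clique //; case: (t \in C).
rewrite (sum_codegree sym x reg); under eq_bigr do rewrite -in_setC.
rewrite sum_mem_card.
have -> : [set y in ~: C | y != x] = ~: C :\ x by apply/setP => y; rewrite !inE andbC.
have := card_clique_compl; rewrite (cardsD1 x) inE xC add1n => -[->].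
exact: leqnn.
Qed.

(** Points are the members of [C], lines the remaining vertices; the two codegree lemmas are the
    axioms on joining points and meeting lines. *)
Lemma large_clique_pp : is_pp_incidence_graph e (r - 1).
Proof.
pose P : finType := {x : T | x \in C}; pose L : finType := {x : T | x \notin C}.
pose inc (p : P) (l : L) := e (val p) (val l).
pose g (u : P + L) : T := match u with inl p => val p | inr l => val l end.
have r1 : (r - 1).+1 = r by lia.
have cP : #|P| = (r * (r - 1)).+1 by rewrite card_sig -card_clique.
have cL : #|L| = (r * (r - 1)).+1.
  by rewrite card_sig -card_clique_compl; apply: eq_card => x; rewrite !inE.
have g_inj : injective g.
  case=> [[x xC]|[x xC]] [[y yC]|[y yC]] /= E; subst.
  - by congr inl; apply: val_inj.
  - by case/negP: (yC).
  - by case/negP: (xC).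
  - by congr inr; apply: val_inj.
have g_bij : bijective g.
  apply: inj_card_bij g_inj _; rewrite card_sum cP cL.
  by rewrite -(cardsC C) card_clique card_clique_compl.
have [f gK fK] := g_bij.
exists P, L, inc, f; split; last 1 first.
- move=> x y; rewrite -{1}(fK x) -{1}(fK y).
  case: (f x) (f y) => [p|l] [p'|l'] //=.
  - apply/negbTE/negP => /clique_bipartite.
    by rewrite (valP p) (valP p').
  - apply/negbTE/negP => /clique_bipartite.
    by rewrite (valP l') (negPf (valP l)).
- split.
  + by rewrite cP cL; split; nia.
  + move=> l; rewrite r1 -(reg (val l)) -(card_imset _ val_inj).
    apply: eq_card => x; rewrite inE; apply/imsetP/idP => [[p]|lx].
      by rewrite inE /inc sym => lp ->.
    have xC : x \in C.
      by have := clique_bipartite lx; rewrite (negPf (valP l)); case: (x \in C).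
    by exists (Sub x xC) => //; rewrite inE /inc sym.
  + move=> p; rewrite r1 -(reg (val p)) -(card_imset _ val_inj).
    apply: eq_card => x; rewrite inE; apply/imsetP/idP => [[l]|px].
      by rewrite inE /inc => lp ->.
    have xC : x \notin C by have := clique_bipartite px; rewrite (valP p).
    by exists (Sub x xC) => //; rewrite inE.
  + move=> p1 p2 p12; have := codegree_clique (valP p1) (_ : val p2 != val p1).
    rewrite eq_sym p12 (valP p2) => /(_ isT) /= <-; rewrite -(card_imset _ val_inj).
    apply: eq_card => x; rewrite !inE; apply/imsetP/idP => [[l]|/andP[x1 x2]].
      by rewrite inE /inc => lp ->.
    have xC : x \notin C by have := clique_bipartite x1; rewrite (valP p1).
    by exists (Sub x xC) => //; rewrite inE /inc x1.
  + move=> l1 l2 l12; have := codegree_clique_compl (valP l1) (_ : val l2 != val l1).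
    rewrite eq_sym l12 (valP l2) => /(_ isT) /= <-; rewrite -(card_imset _ val_inj).
    apply: eq_card => x; rewrite !inE; apply/imsetP/idP => [[p]|/andP[x1 x2]].
      by rewrite inE /inc ![e (val p) _]sym => lp ->.
    have xC : x \in C.
      by have := clique_bipartite x1; rewrite (negPf (valP l1)); case: (x \in C).
    by exists (Sub x xC) => //; rewrite inE /inc ![e x _]sym x1.
- by exists g.
Qed.

End LargeClique.

(** * The domination number and the two cases *)

Lemma bigmin_le (I : eqType) (s : seq I) (P : pred I) (F : I -> nat) m i :
  i \in s -> P i -> \big[minn/m]_(j <- s | P j) F j <= F i.
Proof.
elim: s => // j s IHs; rewrite inE big_cons => /predU1P[<-|/IHs le] Pi.
  by rewrite Pi geq_minl.
by case: ifP => _; rewrite ?geq_min le ?orbT.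
Qed.

Section Gamma.
Variables (T : finType) (e : rel T) (k : nat).

Lemma gamma_ktot_le (S : {set T}) : ktuple_tds e k S -> gamma_ktot e k <= #|S|.
Proof. by move=> tdsS; apply: bigmin_le; rewrite ?mem_index_enum. Qed.

(** The bound on [m] itself covers the default value of the iterated minimum. *)
Lemma le_gamma_ktot m : m <= #|T|.+1 ->
  (forall S : {set T}, ktuple_tds e k S -> m <= #|S|) -> m <= gamma_ktot e k.
Proof.
move=> lem leS; apply: (big_ind (fun n => m <= n)) => // a b ma mb.
by rewrite leq_min ma.
Qed.
End Gamma.

(** With r neighbours at every vertex, having r - 1 of them in [S] means missing at most one. *)
Lemma ktuple_tdsE (T : finType) (e : rel T) r (S : {set T}) :
  0 < r -> regular e r ->
  ktuple_tds e (r - 1) S = [forall v, #|nbhd e v :&: ~: S| <= 1].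
Proof.
move=> r0 reg; apply: eq_forallb => v.
have := cardsID S (nbhd e v); rewrite reg setDE; lia.
Qed.

Lemma stable_share_tds (T : finType) (e : rel T) r (I : {set T}) :
    0 < r -> symmetric e -> regular e r -> stable (share_nbr e) I ->
  ktuple_tds e (r - 1) (~: I).
Proof.
move=> r0 sym reg /stableP stI; rewrite ktuple_tdsE // setCK.
apply/forallP => v; apply/card_le1_eqP => x y.
rewrite !inE => /andP[vx xI] /andP[vy yI]; apply/eqP.
apply: contraLR (stI x y xI yI) => xy; rewrite negbK /share_nbr eq_sym xy.
by apply: (@codegree_gt0 _ _ _ _ v); rewrite sym.
Qed.

Lemma gamma_pp_incidence (T : finType) (e : rel T) r :
    3 <= r -> regular e r -> is_pp_incidence_graph e (r - 1) ->
  #|T| = (r * (r - 1)).+1.*2 /\ gamma_ktot e (r - 1) = (r * (r - 1)).*2.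
Proof.
move=> r3 reg [P [L [inc [f [[[cP cL] _ _ joinP meetL] f_bij eE]]]]].
have [g fK gK] := f_bij.
have [cP' cL'] : #|P| = (r * (r - 1)).+1 /\ #|L| = (r * (r - 1)).+1.
  by rewrite cP cL; split; nia.
have cT : #|T| = (r * (r - 1)).+1.*2.
  by rewrite (bij_eq_card f_bij) card_sum cP' cL' addnn.
split=> //; apply/eqP; rewrite eqn_leq; apply/andP; split.
  have /card_gt0P[p _] : 0 < #|P| by rewrite cP'.
  have /card_gt0P[l _] : 0 < #|L| by rewrite cL'.
  (* A point and a line have no common neighbour, so leaving out one of each still dominates. *)
  pose I := [set g (inl p); g (inr l)].
  have cI : #|I| = 2.
    by rewrite cards2 (inj_eq (can_inj gK)).
  have := @gamma_ktot_le T e (r - 1) (~: I); rewrite cardsCs setCK cT cI.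
  have -> : (r * (r - 1)).+1.*2 - 2 = (r * (r - 1)).*2 by rewrite doubleS subSS subn1.
  apply; rewrite ktuple_tdsE ?setCK //; last by lia.
  apply/forallP => v; apply/card_le1_eqP => x y; rewrite !inE !eE.
  case/andP=> ex /orP[]/eqP xE /andP[ey /orP[]/eqP yE]; subst=> //;
    by move: ex ey; rewrite !gK; case: (f v).
apply: le_gamma_ktot => [|S]; first by rewrite cT doubleS; lia.
rewrite ktuple_tdsE //; last by lia.
move/forallP=> tdsS; have := cardsC S; rewrite cT.
pose left x := if f x is inl _ then true else false.
(* Two points share a line and two lines share a point, so at most one vertex of each side can be
   left out. *)
have part (b : bool) : #|~: S :&: [set x | left x == b]| <= 1.
  apply/card_le1_eqP => x y; rewrite !inE => /andP[xS /eqP xb] /andP[yS /eqP yb].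
  apply/eqP/negPn/negP => xy.
  have [v vx vy] : exists2 v, e v x & e v y.
    have fxy : f x != f y by rewrite (inj_eq (bij_inj f_bij)) eq_sym.
    rewrite /left in xb yb; move: xb yb fxy.
    case fx: (f x) => [p|l]; case fy: (f y) => [p'|l'] <- // _ neq.
      have /eqP/cards1P[l El] := joinP p p' neq.
      have : l \in [set l] by rewrite inE.
      rewrite -El inE => /andP[pl p'l].
      by exists (g (inr l)); rewrite eE gK ?fx ?fy.
    have /eqP/cards1P[p Ep] := meetL l l' neq.
    have : p \in [set p] by rewrite inE.
    rewrite -Ep inE => /andP[pl pl'].
    by exists (g (inl p)); rewrite eE gK ?fx ?fy.
  have := tdsS v; rewrite leqNgt => /card_gt1P; apply.
  by exists x, y; rewrite !inE vx vy eq_sym; split; rewrite // -in_setC.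
have := cardsID [set x | left x == true] (~: S).
have -> : ~: S :\: [set x | left x == true] = ~: S :&: [set x | left x == false].
  by apply/setP => x; rewrite !inE; case: (left x); rewrite ?andbT ?andbF.
have := part true; have := part false; rewrite doubleS; clear; lia.
Qed.

Theorem theorem4 (r : nat) (T : finType) (e : rel T) :
  (3 <= r)%N -> simple_graph e -> connected e -> regular e r ->
  (~ is_pp_incidence_graph e (r - 1) ->
     (((gamma_ktot e (r - 1))%:R : rat)
       <= ((r * (r - 1) - 1)%N%:R / (r * (r - 1))%N%:R) * (#|T|)%:R)%R) /\
  (is_pp_incidence_graph e (r - 1) ->
     (((gamma_ktot e (r - 1))%:R : rat)
       = ((r * (r - 1))%N%:R / (r * (r - 1) + 1)%N%:R) * (#|T|)%:R)%R
     /\ gamma_ktot e (r - 1) = 2 * r * (r - 1)).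
Proof.
move=> r3 [sym irr] conn reg; split=> [npp|pp].
  set D := r * (r - 1); have D3 : 2 < D by rewrite /D; nia.
  have [||I [_ stI leI]] :=
    stable_ratio (A := setT) D3 (share_nbr_sym e) (share_nbr_irr e).
  - move=> x _; under eq_finset do rewrite inE.
    exact: degree_share_nbr.
  - move=> K _ clK; rewrite leqNgt; apply/negP => ltK; apply: npp.
    exact: (large_clique_pp r3 sym irr conn reg clK).
  have leg : gamma_ktot e (r - 1) + #|I| <= #|T|.
    rewrite -(cardsC I) addnC leq_add2l; apply: gamma_ktot_le.
    by apply: stable_share_tds => //; apply: ltnW (ltnW r3).
  rewrite cardsT in leI.
  (* Cleared of the denominator, the claim is D * gamma <= (D - 1) * n, which follows from gamma +
     |I| <= n and n <= D * |I|. *)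
  rewrite mulrAC ler_pdivlMr ?ltr0n ?(ltnW (ltnW D3)) // -!natrM ler_nat.
  by move: leg leI D3; clear; nia.
have [-> ->] := gamma_pp_incidence r3 reg pp; split; last by rewrite -mul2n mulnA.
rewrite addn1 -!mul2n; move: (r * (r - 1)) => D.
by rewrite !natrM mulrCA divfK // pnatr_eq0.
Qed.
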